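(* Let $\varphi,\psi:X\to X$ be a synchronously tame pair of self-maps of a topological space $X$. If the synchronization zeta function $S_{\varphi,\psi}(z)$ is rational, then for every $n\in\mathbb N$ $$\sum_{k\mid n}\mu(n/k)\cdot\#S(\varphi^k,\psi^k)\equiv0\pmod n .$$
   Context: $\mathbb N$ is the set of positive integers and $\mu$ is the Möbius function. For $\varphi,\psi:X\to X$, $S(\varphi^n,\psi^n)=\{x\in X:\varphi^n(x)=\psi^n(x)\}$. The pair is synchronously tame if $\#S(\varphi^n,\psi^n)<\infty$ for all $n\in\mathbb N$. The synchronization zeta function is $S_{\varphi,\psi}(z)=\exp\left(\sum_{n\ge1}\frac{\#S(\varphi^n,\psi^n)}{n}z^n\right)$. *)

(* Defs.v *)
From mathcomp Require Import all_boot all_order all_algebra finmap.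
From mathcomp Require Import all_classical all_reals all_analysis.
From mathcomp Require Import complex.

Set Implicit Arguments.
Unset Strict Implicit.
Unset Printing Implicit Defensive.

Import Order.TTheory GRing.Theory Num.Theory.

Local Open Scope classical_set_scope.
Local Open Scope fset_scope.
Local Open Scope ring_scope.

(* Only meaningful for n > 0. *)
Definition mobius (n : nat) : int :=
  if all (fun p => logn p n == 1%N) (primes n) then (-1) ^+ size (primes n)
  else 0.

Section Synchronization.
Variables (X : choiceType) (phi psi : X -> X).

Definition sync_set (n : nat) : set X :=
  [set x | iter n phi x = iter n psi x].

Definition sync_tame : Prop :=
  forall n : nat, (0 < n)%N -> finite_set (sync_set n).

(* The cardinality of sync_set n when this set is finite; fset_set sends
   infinite sets to the empty one. *)
Definition sync_count (n : nat) : nat := #|` fset_set (sync_set n)|.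

End Synchronization.

(* A formal power series \sum_n (f n) z^n is encoded by its coefficient
   sequence f : nat -> K. *)
Section FormalPowerSeries.
Variable K : fieldType.
Implicit Types f g : nat -> K.

Definition fps_one : nat -> K := fun n => (n == 0%N)%:R.

Definition fps_mul f g : nat -> K :=
  fun n => \sum_(i < n.+1) f i * g (n - i)%N.

Definition fps_pow f (k : nat) : nat -> K := iter k (fps_mul f) fps_one.

(* exp f = \sum_k f^k / k!, for f without constant term (and K of
   characteristic 0): then f^k has no terms of degree < k, so only the k <= n
   contribute to the coefficient of z^n. *)
Definition fps_exp f : nat -> K :=
  fun n => \sum_(k < n.+1) fps_pow f k n / k`!%:R.

(* f is the expansion at 0 of a rational function P / Q. *)
Definition fps_rational f : Prop :=
  exists P Q : {poly K},
    Q != 0 /\ fps_mul (fun i => Q`_i) f = (fun i => P`_i).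

End FormalPowerSeries.

Definition sync_zeta (K : fieldType) (X : choiceType) (phi psi : X -> X) :
    nat -> K :=
  fps_exp (fun n => if n == 0%N then 0
                    else (sync_count phi psi n)%:R / n%:R).
Arguments sync_zeta K {X} phi psi.

(* Main.v *)
Require Import Defs.
From HB Require Import structures.
From mathcomp Require Import all_boot all_order all_algebra.
From mathcomp Require Import all_classical all_reals all_analysis.
From mathcomp Require Import complex polyorder.
From mathcomp Require Import ring zify.

(* Let A = \sum_n #S(phi^n, psi^n) z^n and let theta = z d/dz, so that the
   zeta function F satisfies theta F = A F. Rationality over C descends to Q by
   linear algebra, hence F = T / S up to a constant, with S, T coprime primitive
   integer polynomials. Since A is integral, a Bezout identity and Gauss's lemma
   for power series (as in the proof of Fatou's lemma) show that theta S / S and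
   theta T / T are integral. A primitive S with S(0) <> 0 and theta S / S
   integral is invertible in Z[[z]]: writing S = G S1 and S' = G T1 with
   G = gcd(S, S'), the same argument makes S1 invertible, and one concludes by
   induction with G. Hence F has integer coefficients. Multiplying F successively
   by (1 - z^N)^c, with c the coefficient of z^N, removes the coefficients of A
   one by one, each time changing the Moebius sum at n by c N if n = N and by 0
   otherwise. *)

Set Implicit Arguments.
Unset Strict Implicit.
Unset Printing Implicit Defensive.

Import Order.TTheory GRing.Theory Num.Theory.

Local Open Scope ring_scope.

(** * Formal power series *)

(** Wrapping the coefficient sequence in a record keeps the convolution product apart from pointwise
    operations on functions. *)
Record pseries (R : Type) := PSeries { pscoef :> nat -> R }.

Lemma psP (R : Type) (f g : pseries R) : f =1 g -> f = g.
Proof. by case: f g => [f] [g] /= /funext ->. Qed.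

HB.instance Definition _ (R : Type) := gen_eqMixin (pseries R).
HB.instance Definition _ (R : Type) := gen_choiceMixin (pseries R).

Section PowerSeriesZmodule.
Variable R : zmodType.
Implicit Types f g h : pseries R.

Definition ps_add f g := PSeries (fun n => f n + g n).
Definition ps_opp f := PSeries (fun n => - f n).
Definition ps_zero : pseries R := PSeries (fun _ => 0).

Fact ps_addA : associative ps_add.
Proof. by move=> f g h; apply: psP => n /=; rewrite addrA. Qed.

Fact ps_addC : commutative ps_add.
Proof. by move=> f g; apply: psP => n /=; rewrite addrC. Qed.

Fact ps_add0 : left_id ps_zero ps_add.
Proof. by move=> f; apply: psP => n /=; rewrite add0r. Qed.

Fact ps_addN : left_inverse ps_zero ps_opp ps_add.
Proof. by move=> f; apply: psP => n /=; rewrite addNr. Qed.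

HB.instance Definition _ :=
  GRing.isZmodule.Build (pseries R) ps_addA ps_addC ps_add0 ps_addN.

End PowerSeriesZmodule.

Section PowerSeriesRing.
Variable R : comNzRingType.
Implicit Types f g h : pseries R.

Definition ps_one : pseries R := PSeries (fun n => (n == 0%N)%:R).
Definition ps_mul f g : pseries R :=
  PSeries (fun n => \sum_(i < n.+1) f i * g (n - i)%N).

Definition ps_trunc N f : {poly R} := \poly_(i < N) f i.

(* Products of series are computed on truncations, so that the ring axioms
   follow from those of polynomials. *)
Lemma ps_mul_trunc N f g n : (n < N)%N ->
  ps_mul f g n = (ps_trunc N f * ps_trunc N g)`_n.
Proof.
move=> ltnN; rewrite coefM; apply: eq_bigr => i _.
rewrite !coef_poly (leq_ltn_trans (leq_ord i)) //.
by rewrite (leq_ltn_trans (leq_subr _ _)).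
Qed.

Lemma ps_trunc_mul N f g n : (n < N)%N ->
  (ps_trunc N (ps_mul f g))`_n = (ps_trunc N f * ps_trunc N g)`_n.
Proof. by move=> ltnN; rewrite coef_poly ltnN (ps_mul_trunc _ _ ltnN). Qed.

Fact ps_mulC : commutative ps_mul.
Proof.
by move=> f g; apply: psP => n; rewrite !(ps_mul_trunc _ _ (ltnSn n)) mulrC.
Qed.

Fact ps_mulA : associative ps_mul.
Proof.
move=> f g h; apply: psP => n; rewrite !(ps_mul_trunc _ _ (ltnSn n)).
transitivity ((ps_trunc n.+1 f * ps_trunc n.+1 g * ps_trunc n.+1 h)`_n).
  rewrite -mulrA !coefM; apply: eq_bigr => i _; congr (_ * _).
  by rewrite ps_trunc_mul // ltnS leq_subr.
by rewrite !coefM; apply: eq_bigr => i _; congr (_ * _); rewrite ps_trunc_mul.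
Qed.

Fact ps_mul1 : left_id ps_one ps_mul.
Proof.
move=> f; apply: psP => n /=; rewrite big_ord_recl /= mul1r subn0 big1 ?addr0//.
by move=> i _; rewrite mul0r.
Qed.

Fact ps_mulDl : left_distributive ps_mul +%R.
Proof.
move=> f g h; apply: psP => n /=; rewrite -big_split /=.
by apply: eq_bigr => i _; rewrite mulrDl.
Qed.

Fact ps_one_neq0 : ps_one != 0.
Proof.
apply/eqP => /(congr1 (fun f : pseries R => f 0%N)) /eqP /=.
by rewrite oner_eq0.
Qed.

HB.instance Definition _ := GRing.Zmodule_isComNzRing.Build (pseries R)
  ps_mulA ps_mulC ps_mul1 ps_mulDl ps_one_neq0.

Lemma psD f g n : (f + g) n = f n + g n. Proof. by []. Qed.
Lemma psN f n : (- f) n = - f n. Proof. by []. Qed.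
Lemma psM f g n : (f * g) n = \sum_(i < n.+1) f i * g (n - i)%N.
Proof. by []. Qed.
Lemma ps1 n : (1 : pseries R) n = (n == 0%N)%:R. Proof. by []. Qed.
Lemma ps0 n : (0 : pseries R) n = 0. Proof. by []. Qed.

Lemma psM0 f g : (f * g) 0%N = f 0%N * g 0%N.
Proof. by rewrite psM big_ord1. Qed.

Lemma ps_sum (I : Type) (r : seq I) (P : pred I) (F : I -> pseries R) n :
  (\sum_(i <- r | P i) F i) n = \sum_(i <- r | P i) F i n.
Proof. by elim/big_rec2: _ => [//|i f x _ <-]; rewrite psD. Qed.

Definition ps_theta f : pseries R := PSeries (fun n => n%:R * f n).

Fact ps_theta_zmod : zmod_morphism ps_theta.
Proof. by move=> f g; apply: psP => n; rewrite /= mulrBr. Qed.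

HB.instance Definition _ :=
  GRing.isZmodMorphism.Build (pseries R) (pseries R) ps_theta ps_theta_zmod.

Lemma ps_thetaM f g : ps_theta (f * g) = ps_theta f * g + f * ps_theta g.
Proof.
apply: psP => n; rewrite psD !psM /= mulr_sumr -big_split /=.
apply: eq_bigr => i _; rewrite -[in n%:R](subnKC (leq_ord i)) natrD; ring.
Qed.

Definition ps_of_poly (p : {poly R}) : pseries R := PSeries (fun n => p`_n).

Fact ps_of_poly_zmod : zmod_morphism ps_of_poly.
Proof. by move=> p q; apply: psP => n; rewrite /= coefB. Qed.

Fact ps_of_poly_monoid : monoid_morphism ps_of_poly.
Proof.
split=> [|p q]; apply: psP => n; first by rewrite /= coef1.
by rewrite psM /= coefM.
Qed.

HB.instance Definition _ :=
  GRing.isZmodMorphism.Build {poly R} (pseries R) ps_of_poly ps_of_poly_zmod.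
HB.instance Definition _ :=
  GRing.isMonoidMorphism.Build {poly R} (pseries R) ps_of_poly
    ps_of_poly_monoid.

Lemma ps_of_poly_inj : injective ps_of_poly.
Proof.
by move=> p q eqpq; apply/polyP => n; apply: (congr1 (@pscoef R ^~ n) eqpq).
Qed.

Lemma ps_theta_poly p : ps_theta (ps_of_poly p) = ps_of_poly ('X * p^`()).
Proof.
apply: psP => -[|n] /=; rewrite coefXM ?mul0r //= coef_deriv.
by rewrite mulr_natl.
Qed.

Lemma ps_mulC_poly c f n : (ps_of_poly c%:P * f) n = c * f n.
Proof.
rewrite psM big_ord_recl /= coefC /= subn0 big1 ?addr0 // => i _.
by rewrite coefC mul0r.
Qed.

End PowerSeriesRing.

Section PowerSeriesMap.
Variables (R S : comNzRingType) (phi : {rmorphism R -> S}).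

Definition ps_map (f : pseries R) : pseries S := PSeries (phi \o f).

Fact ps_map_zmod : zmod_morphism ps_map.
Proof. by move=> f g; apply: psP => n; rewrite /= rmorphB. Qed.

Fact ps_map_monoid : monoid_morphism ps_map.
Proof.
split=> [|f g]; apply: psP => n; first by rewrite /= rmorph_nat.
by rewrite psM /= rmorph_sum; apply: eq_bigr => i _; rewrite rmorphM.
Qed.

HB.instance Definition _ :=
  GRing.isZmodMorphism.Build (pseries R) (pseries S) ps_map ps_map_zmod.
HB.instance Definition _ :=
  GRing.isMonoidMorphism.Build (pseries R) (pseries S) ps_map ps_map_monoid.

Lemma ps_map_poly p : ps_map (ps_of_poly p) = ps_of_poly (map_poly phi p).
Proof. by apply: psP => n; rewrite /= coef_map. Qed.

Lemma ps_map_theta f : ps_map (ps_theta f) = ps_theta (ps_map f).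
Proof. by apply: psP => n; rewrite /= rmorphM rmorph_nat. Qed.

Lemma ps_map_inj : injective phi -> injective ps_map.
Proof.
by move=> inj f g [eqfg]; apply: psP => n; apply: inj;
  have /= := congr1 (@^~ n) eqfg.
Qed.

End PowerSeriesMap.

Section PowerSeriesDomain.
Variable R : idomainType.
Implicit Types f g h : pseries R.

Lemma ps_neq0 f : f != 0 ->
  exists n, f n != 0 /\ forall i, (i < n)%N -> f i = 0.
Proof.
move=> nzf; have exn : exists n, f n != 0.
  apply/not_existsP => f0; case/eqP: nzf; apply: psP => n.
  by have /negP := f0 n; rewrite negbK => /eqP.
exists (ex_minn exn); case: ex_minnP => n nzn minn; split=> // i.
by rewrite ltnNge; apply: contraNeq => /minn.
Qed.

(** If [i] and [j] are the orders of [f] and [g], only the term [f i * g j] survives in the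
    coefficient of the product at [i + j]. *)
Lemma ps_mulf_eq0 f g : f * g = 0 -> f = 0 \/ g = 0.
Proof.
move=> fg0; have [|/ps_neq0 [i [nzi fi]]] := eqVneq f 0; first by left.
have [|/ps_neq0 [j [nzj gj]]] := eqVneq g 0; first by right.
have /eqP := congr1 (fun h : pseries R => h (i + j)%N) fg0.
have lti : (i < (i + j).+1)%N by rewrite ltnS leq_addr.
rewrite psM (bigD1 (Ordinal lti)) //= addKn big1 ?addr0.
  by rewrite mulf_eq0 (negPf nzi) (negPf nzj).
move=> k; rewrite -val_eqE /= => neki; have [ltki|leik] := ltnP k i.
  by rewrite fi ?mul0r.
rewrite gj ?mulr0 //; have := ltn_ord k; lia.
Qed.

Lemma ps_mulfI f : f != 0 -> injective ( *%R f).
Proof.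
move=> nzf g h /eqP; rewrite -subr_eq0 -mulrBr => /eqP /ps_mulf_eq0 [f0|].
  by rewrite f0 eqxx in nzf.
by move/eqP; rewrite subr_eq0 => /eqP.
Qed.

End PowerSeriesDomain.

(** * Gauss's lemma and Bezout identities over the integers *)

Section IntegerPolynomials.
Implicit Types P Q K U V : {poly int}.
Local Notation ps := (@ps_of_poly int).

Lemma ps_neq0_poly P : P != 0 -> ps P != 0.
Proof.
by apply: contraNneq => P0; apply/eqP/ps_of_poly_inj; rewrite P0 rmorph0.
Qed.

Lemma primitive_neq0 P : zcontents P = 1 -> P != 0.
Proof. by move=> cP; rewrite -zcontents_eq0 cP oner_eq0. Qed.

(** The prime factors of [m] are removed one at a time. Modulo a prime p dividing [m] the product
    [ps P * Y] vanishes, while the primitive [P] does not; since F_p[[z]] is a domain, p divides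
    every coefficient of [Y]. *)
Lemma gauss_series P (m : nat) K (Y : pseries int) : zcontents P = 1 ->
  (0 < m)%N -> ps (m%:Z *: K) = ps P * Y -> exists Y', ps K = ps P * Y'.
Proof.
move=> cP; elim/ltn_ind: m Y => m IH Y m_gt0 eqY.
have [m1|m_neq1] := eqVneq m 1%N; first by exists Y; rewrite -eqY m1 scale1r.
have prp : prime (pdiv m) by rewrite pdiv_prime // ltn_neqAle eq_sym m_neq1.
have [m' em] : exists m', m = (pdiv m * m')%N.
  by exists (m %/ pdiv m)%N; rewrite mulnC divnK ?pdiv_dvd.
set p := pdiv m in prp em.
have dvdF (a : int) : (a%:~R == 0 :> 'F_p) = (p %| a)%Z.
  by rewrite (dvdz_pcharf (pchar_Fp prp)).
pose r := ps_map (intr : int -> 'F_p).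
have rY0 : r Y = 0.
  have : r (ps P) * r Y = 0.
    rewrite -rmorphM -eqY; apply: psP => n /=.
    by apply/eqP; rewrite dvdF coefZ em PoszM -mulrA dvdz_mulr.
  case/ps_mulf_eq0 => // rP0.
  have : (p%:Z %| zcontents P)%Z.
    rewrite dvdz_contents; apply/polyOverP => i.
    rewrite -dvdF; apply/eqP.
    exact: (congr1 (@pscoef _ ^~ i) rP0).
  by rewrite cP dvdz1 /= => /eqP p1; rewrite p1 in prp.
have dvdY n : (p%:Z %| Y n)%Z.
  rewrite -dvdF; apply/eqP; exact: (congr1 (@pscoef _ ^~ n) rY0).
pose Y1 : pseries int := PSeries (fun n => Y n %/ p%:Z)%Z.
have m'_gt0 : (0 < m')%N by move: m_gt0; rewrite em muln_gt0 => /andP[].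
apply: (IH m' _ Y1) => //.
  by rewrite em ltn_Pmull // prime_gt1.
have pn0 : p%:Z%:P != 0 :> {poly int}.
  by rewrite polyC_eq0 eqz_nat -lt0n prime_gt0.
apply: (ps_mulfI (ps_neq0_poly pn0)).
have -> : ps p%:Z%:P * ps (m'%:Z *: K) = ps P * Y.
  by rewrite -rmorphM mul_polyC scalerA -PoszM -em.
rewrite mulrCA; congr (_ * _).
by apply: psP => n; rewrite ps_mulC_poly /= mulrC divzK.
Qed.

Lemma gauss_series_int P (m : int) K (Y : pseries int) : zcontents P = 1 ->
  m != 0 -> ps (m *: K) = ps P * Y -> exists Y', ps K = ps P * Y'.
Proof.
move=> cP nzm eqY; apply: (@gauss_series P `|m|%N K (ps (sgz m)%:P * Y) cP).
  by rewrite absz_gt0.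
by rewrite mulrCA -eqY -rmorphM mul_polyC scalerA abszEsg.
Qed.

Lemma poly_int_bezout P Q : P != 0 ->
  exists G S T U V, exists m : int,
    [/\ zcontents G = 1, P = G * S, Q = G * T, U * S + V * T = m%:P & m != 0].
Proof.
move=> nzP; set g := gcdp P Q.
have nzg : g != 0 by rewrite gcdp_eq0 negb_and nzP.
have [S eS] := dvdpP_int (dvdp_gcdl P Q).
have [T eT] := dvdpP_int (dvdp_gcdr P Q).
have [[u v] /eqpP[[c1 c2] /andP[/= nz1 nz2] eb]] := Bezoutp P Q.
rewrite -/g in eS eT eb.
(* Pseudo-division gives [c1 *: (u * P + v * Q) = c2 *: g]. Cancelling the primitive part of [g]
   leaves the constant [c2 * zcontents g]. *)
exists (zprimitive g), S, T, (c1 *: u), (c1 *: v), (c2 * zcontents g).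
split=> //; first by rewrite zcontents_primitive nzg.
  have nzG : zprimitive g != 0 by rewrite zprimitive_eq0.
  apply: (mulfI nzG); rewrite mulrDr mulrCA -eS mulrCA -eT -!scalerAl -scalerDr.
  by rewrite eb [in LHS](zpolyEprim g) scalerA -mul_polyC mulrC.
by rewrite mulf_neq0 // zcontents_eq0.
Qed.

Lemma primitive_factor P Q : zcontents (P * Q) = 1 -> zcontents P = 1 ->
  zcontents Q = 1.
Proof. by rewrite zcontentsM => + cP; rewrite cP mul1r. Qed.

Lemma log_derivative_unit P (B : pseries int) : zcontents P = 1 -> P`_0 != 0 ->
  ps_theta (ps P) = ps P * B -> exists Y, ps P * Y = 1.
Proof.
have [n] := ubnP (size P); elim: n P B => // n IH P B lePn cP P0 eqB.
have nzP := primitive_neq0 cP.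
(* [zcontents] carries the sign of the leading coefficient, so a constant is its own content and
   here equals 1. *)
have [/size1_polyC eP|gtP] := leqP (size P) 1.
  exists 1; suff P1 : P`_0 = 1 by rewrite eP P1 rmorph1 mulr1.
  rewrite -cP [in RHS]eP -[_%:P]alg_polyC zcontentsZ.
  by rewrite zcontents_monic ?monic1 ?mulr1.
have [G [S [T [U [V [m [cG eP eP' eb nzm]]]]]]] := poly_int_bezout P^`() nzP.
have cS : zcontents S = 1 by rewrite eP in cP; apply: primitive_factor cP cG.
have nzG := primitive_neq0 cG.
have nzS := primitive_neq0 cS.
have /andP[G0 S0] : (G`_0 != 0) && (S`_0 != 0).
  by move: P0; rewrite eP coefM big_ord1 subnn mulf_eq0 negb_or.
have eXT : ps ('X * T) = ps S * B.
  apply: (ps_mulfI (ps_neq0_poly nzG)); rewrite mulrA -!rmorphM -eP -eqB.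
  by rewrite ps_theta_poly eP' mulrCA.
(* [S] divides the nonzero constant [m * S]_0[in Z[[z]]: write]S[_0] as [S - 'X * S'], then [m] as
   [U * S + V * T], and use that [S] divides ['X * T]. Gauss's lemma then removes the constant. *)
have [Y eY] : exists Y, 1 = ps S * Y.
  pose S' := drop_poly 1 S.
  have eS : S = (S`_0)%:P + 'X * S'.
    rewrite -[LHS](poly_take_drop 1) -/S' mulrC; congr (_ + _).
    by apply/polyP => -[|i]; rewrite coef_take_poly coefC.
  have eX : ps (m * S`_0)%:P =
      ps S * (ps m%:P - ps S' * (ps ('X * U) + ps V * B)).
    have -> : ps (m * S`_0)%:P =
        ps S * ps m%:P - ps S' * (ps S * ps ('X * U) + ps V * ps ('X * T)).
      rewrite -!rmorphM -rmorphD -!rmorphM -rmorphB; congr ps.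
      rewrite [X in X * m%:P]eS polyCM -eb; ring.
    by rewrite eXT; ring.
  have nzmS : m * S`_0 != 0 by rewrite mulf_neq0.
  have := @gauss_series_int S (m * S`_0) 1 _ cS nzmS.
  rewrite -mul_polyC mulr1 eX => /(_ _ erefl) [Y eY].
  by exists Y; rewrite -eY rmorph1.
have nzdP : P^`() != 0 by rewrite -size_poly_gt0 size_deriv;
  case: (size P) gtP => [|[]].
have nzT : T != 0 by apply: contraNneq nzdP => T0; rewrite eP' T0 mulr0.
(* The induction descends because [G] divides the nonzero derivative of [P]. *)
have ltGP : (size G < n)%N.
  rewrite -ltnS; apply: leq_trans lePn; rewrite ltnS.
  apply: leq_ltn_trans (lt_size_deriv nzP); rewrite eP' size_mul //.
  by rewrite -subn1 -addnBA ?leq_addr // size_poly_gt0.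
(* Since P = G S, the logarithmic derivative of [G] is that of [P] minus that of [S], and [Y] is the
   inverse of [S]. *)
have [|Y' eY'] := IH G (B - ps_theta (ps S) * Y) ltGP cG G0.
  apply: (ps_mulfI (ps_neq0_poly nzS)).
  have : ps_theta (ps G) * ps S + ps G * ps_theta (ps S) = ps G * ps S * B.
    by rewrite -ps_thetaM -!rmorphM -eP.
  move/(canRL (addrK _)); rewrite [LHS]mulrC => ->.
  rewrite -[X in _ - X]mulr1 eY; ring.
exists (Y * Y'); rewrite eP rmorphM [_ * ps S]mulrC mulrACA -eY eY' mulr1.
by [].
Qed.
End IntegerPolynomials.

(** * Integrality *)

Section Integrality.
Implicit Types P Q U V : {poly int}.
Local Notation ps := (@ps_of_poly int).
Local Notation iota := (ps_map (intr : int -> rat)).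

(** Multiplying the Bezout identity by theta P shows that [P] divides m theta P in Z[[z]]; Gauss's
    lemma removes [m]. *)
Lemma primitive_log_derivative P Q U V (m : int) (W : pseries int) :
    zcontents P = 1 -> U * P + V * Q = m%:P -> m != 0 ->
    ps_theta (ps P) * ps Q = ps P * W ->
  exists B, ps_theta (ps P) = ps P * B.
Proof.
move=> cP eb nzm eW; rewrite ps_theta_poly in eW *.
apply: (@gauss_series_int P m _ (ps U * ps ('X * P^`()) + ps V * W)) => //.
rewrite -mul_polyC -eb mulrDl rmorphD !rmorphM.
have -> : ps V * ps Q * (ps 'X * ps P^`()) = ps V * (ps ('X * P^`()) * ps Q).
  by rewrite rmorphM; ring.
by rewrite eW; ring.
Qed.

Lemma ps_unit0 (f g : pseries int) : f * g = 1 -> f 0%N * g 0%N = 1.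
Proof. by move=> fg1; rewrite -psM0 fg1. Qed.

Lemma iota_inj : injective iota.
Proof. exact/ps_map_inj/intr_inj. Qed.

Lemma iota_neq0 P : P != 0 -> iota (ps P) != 0.
Proof.
by move=> nzP; rewrite -(rmorph0 iota) (inj_eq iota_inj) ps_neq0_poly.
Qed.

Lemma rational_int_poly (F : pseries rat) (P Q : {poly rat}) : Q != 0 ->
    ps_of_poly Q * F = ps_of_poly P ->
  exists P' Q', Q' != 0 /\ iota (ps Q') * F = iota (ps P').
Proof.
move=> nzQ eF; have [Q1 [b nzb eQ]] := rat_poly_scale Q.
have [P1 [a nza eP]] := rat_poly_scale P.
have nza' : a%:~R != 0 :> rat by rewrite intr_eq0.
have nzb' : b%:~R != 0 :> rat by rewrite intr_eq0.
have eQ1 : iota (ps Q1) = ps_of_poly (b%:~R%:P * Q).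
  by rewrite ps_map_poly eQ mul_polyC scalerA divff ?scale1r.
have eP1 : iota (ps P1) = ps_of_poly (a%:~R%:P * P).
  by rewrite ps_map_poly eP mul_polyC scalerA divff ?scale1r.
(* [a] clears the denominators of [P] and [b] those of [Q], so the equation is multiplied by
   [a * b]. *)
exists (b%:P * P1), (a%:P * Q1); split.
  rewrite mulf_neq0 ?polyC_eq0 //; apply: contraNneq nzQ => Q10.
  by rewrite eQ Q10 rmorph0 scaler0.
have iotaC (c : int) : iota (ps c%:P) = ps_of_poly c%:~R%:P.
  by rewrite ps_map_poly map_polyC.
rewrite !rmorphM /= !iotaC eQ1 eP1 !rmorphM /= -eF; ring.
Qed.

Theorem rational_series_integral (F : pseries rat) (A : pseries int)
    (P Q : {poly rat}) :
    Q != 0 -> ps_of_poly Q * F = ps_of_poly P -> F 0%N = 1 ->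
    ps_theta F = iota A * F ->
  exists H : pseries int, F = iota H.
Proof.
move=> nzQ eF F0 dF; have [P0 [Q0 [nzQ0 {}eF]]] := rational_int_poly nzQ eF.
have [G [S [T [U [V [m [cG eQ eP eb nzm]]]]]]] := poly_int_bezout P0 nzQ0.
have nzG := primitive_neq0 cG.
have nzS : S != 0 by apply: contraNneq nzQ0 => S0; rewrite eQ S0 mulr0.
have eST : iota (ps S) * F = iota (ps T).
  by apply: (ps_mulfI (iota_neq0 nzG)); rewrite mulrA -!rmorphM -eQ -eP.
have nzF : F != 0 by apply: contra_eq_neq F0 => ->; rewrite ps0 eq_sym oner_eq0.
have nzT : T != 0.
  apply: contraNneq nzF => T0; apply/eqP/(ps_mulfI (iota_neq0 nzS)).
  by rewrite mulr0 eST T0 !rmorph0.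
have ST0 : S`_0 = T`_0.
  apply: (@intr_inj rat); have /= := congr1 (fun f : pseries rat => f 0%N) eST.
  by rewrite big_ord1 /= F0 mulr1.
(* If S(0) = T(0) = 0, the constant term of the Bezout identity would give [m = 0]. *)
have S0 : S`_0 != 0.
  apply: contraNneq nzm => S0; move/(congr1 (fun p : {poly int} => p`_0)): eb.
  by rewrite coefD !coefM !big_ord1 !subnn -ST0 S0 !mulr0 addr0 coefC /= => <-.
(* This is theta F = A F with F = T / S, cleared of denominators. *)
have dST : ps_theta (ps S) * ps T + ps S * A * ps T = ps S * ps_theta (ps T).
  apply: iota_inj; rewrite rmorphD !rmorphM /= !ps_map_theta -eST ps_thetaM dF.
  ring.
have primitive_part (p : {poly int}) : p != 0 ->
    exists c p1, [/\ c != 0, p = c%:P * p1 & zcontents p1 = 1].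
  move=> nzp; exists (zcontents p), (zprimitive p).
  by rewrite zcontents_eq0 mul_polyC -zpolyEprim zcontents_primitive nzp.
have [c [S1 [nzc eS cS1]]] := primitive_part S nzS.
have [d [T1 [nzd eT cT1]]] := primitive_part T nzT.
have S10 : S1`_0 != 0.
  by move: S0; rewrite eS coefCM mulf_eq0 negb_or => /andP[].
have T10 : T1`_0 != 0.
  by move: S0; rewrite ST0 eT coefCM mulf_eq0 negb_or => /andP[].
have theta_poly0 (e : int) : ps_theta (ps e%:P) = 0.
  by rewrite ps_theta_poly derivC mulr0 rmorph0.
(* As theta is linear over constants, the contents [c] and [d] cancel and the identity passes to the
   primitive parts. *)
have dST1 : ps_theta (ps S1) * ps T1 + ps S1 * A * ps T1
    = ps S1 * ps_theta (ps T1).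
  have nzcd : c%:P * d%:P != 0 :> {poly int} by rewrite mulf_neq0 ?polyC_eq0.
  apply: (ps_mulfI (ps_neq0_poly nzcd)); move: dST.
  rewrite eS eT !rmorphM !ps_thetaM !theta_poly0 !mul0r !add0r.
  set C := ps c%:P; set D := ps d%:P => dST.
  transitivity (C * ps_theta (ps S1) * (D * ps T1)
    + C * ps S1 * A * (D * ps T1)); first by ring.
  by rewrite dST; ring.
have eb1 : (c%:P * U) * S1 + (d%:P * V) * T1 = m%:P.
  by rewrite -eb [in RHS]eS [in RHS]eT; ring.
have [B eB] : exists B, ps_theta (ps S1) = ps S1 * B.
  apply: (primitive_log_derivative cS1 eb1 nzm
    (W := ps_theta (ps T1) - A * ps T1)).
  by rewrite mulrBr -dST1; ring.
have [B' eB'] : exists B, ps_theta (ps T1) = ps T1 * B.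
  rewrite addrC in eb1; apply: (primitive_log_derivative cT1 eb1 nzm
    (W := ps_theta (ps S1) + ps S1 * A)).
  by rewrite mulrC -dST1; ring.
have [Y eY] := log_derivative_unit cS1 S10 eB.
have [Y' eY'] := log_derivative_unit cT1 T10 eB'.
have /= S1Y := ps_unit0 eY; have /= T1Y := ps_unit0 eY'.
(* F = (d / c) T1 / S1, where [Y] inverts [S1]. From S(0) = T(0) follows d / c = S1(0) / T1(0), and
   [Y' 0] is the inverse of T1(0). *)
exists (ps (S1`_0 * Y' 0%N)%:P * ps T1 * Y).
have nzcC : c%:P != 0 :> {poly int} by rewrite polyC_eq0.
apply: (ps_mulfI (iota_neq0 nzcC)).
have ecd : c * S1`_0 * Y' 0%N = d.
  have := ST0; rewrite eS eT !coefCM => ->.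
  by rewrite -mulrA T1Y mulr1.
rewrite -[LHS]mul1r -(rmorph1 iota) -eY rmorphM.
transitivity (iota Y * (iota (ps S) * F)).
  by rewrite eS !rmorphM; ring.
rewrite eST eT -ecd -!mulrA !polyCM !rmorphM; ring.
Qed.

End Integrality.

(** * Moebius sums *)

Section Mobius.

Lemma mobius_square (p n : nat) : prime p -> (0 < n)%N -> (p * p %| n)%N ->
  mobius n = 0.
Proof.
move=> prp n_gt0 dvd; rewrite /mobius; case: allP => // /(_ p).
rewrite mem_primes prp n_gt0 (dvdn_trans (dvdn_mulr _ _) dvd) //.
move=> /(_ isT)/eqP lg.
by move: dvd; rewrite mulnn pfactor_dvdn // lg.
Qed.

Lemma mobius_primeM (p n : nat) : prime p -> (0 < n)%N -> ~~ (p %| n)%N ->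
  mobius (p * n) = - mobius n.
Proof.
move=> prp n_gt0 ndvd; have p_gt0 := prime_gt0 prp.
have pM : perm_eq (primes (p * n)) (p :: primes n).
  apply: uniq_perm; rewrite /= ?primes_uniq ?mem_primes ?(negPf ndvd) ?andbF //.
  by move=> q; rewrite primesM // primes_prime // !inE.
rewrite /mobius (perm_all _ pM) (perm_size pM) /= exprS mulN1r.
rewrite lognM // logn_prime // eqxx (lognE p n) (negPf ndvd) !andbF /=.
set b := all _ _; set c := all _ _.
have -> : b = c; last by case: c; rewrite ?oppr0.
apply: eq_in_all => q; rewrite mem_primes => /and3P[prq _ dvdq].
rewrite lognM // logn_prime //; have [eqpq|//] := eqVneq q p.
by rewrite -eqpq dvdq in ndvd.
Qed.

(** Fix a prime p dividing [n]. Divisors divisible by p^2 contribute 0; the other multiples of p are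
    the p d with [d] a divisor prime to p, and each cancels against [d]. *)
Lemma sum_mobius (n : nat) : (1 < n)%N -> \sum_(d <- divisors n) mobius d = 0.
Proof.
move=> n_gt1; have n_gt0 := ltnW n_gt1.
set p := pdiv n; have prp : prime p := pdiv_prime n_gt1.
have p_gt0 := prime_gt0 prp.
pose s1 := [seq d <- divisors n | ~~ (p %| d)%N].
rewrite (bigID (fun d => p %| d)%N) /= addrC -big_filter -/s1.
rewrite [X in _ + X](bigID (fun d => p * p %| d)%N) /=.
rewrite [X in _ + (X + _)]big_seq_cond.
rewrite [X in _ + (X + _)]big1 ?add0r; last first.
  move=> d /and3P[]; rewrite -dvdn_divisors // => dvdn _.
  exact/mobius_square/(dvdn_gt0 n_gt0 dvdn).
rewrite -[X in _ + X]big_filter.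
rewrite [X in _ + X](perm_big [seq (p * d)%N | d <- s1]) /=.
  rewrite big_map -big_split big_seq big1 // => d.
  rewrite mem_filter -dvdn_divisors // => /andP[ndvd dvdn].
  by rewrite mobius_primeM ?(dvdn_gt0 n_gt0 dvdn) //= subrr.
apply: uniq_perm.
- by rewrite filter_uniq // divisors_uniq.
- rewrite map_inj_uniq ?filter_uniq ?divisors_uniq // => d e /eqP.
  by rewrite eqn_pmul2l // => /eqP.
move=> d; apply/idP/mapP => [|[e]]; rewrite !mem_filter -!dvdn_divisors //.
  case/andP=> /andP[/dvdnP[e ->]]; rewrite mulnC dvdn_pmul2l // => ndvd dvdn.
  exists e; rewrite ?mem_filter ?ndvd // -dvdn_divisors //.
  exact: dvdn_trans (dvdn_mull _ _) dvdn.
case/andP=> ndvd dvdn ->; rewrite dvdn_mulr // dvdn_pmul2l // ndvd /=.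
by rewrite Gauss_dvd ?pdiv_dvd // prime_coprime.
Qed.

Definition mobius_sum (a : nat -> int) (n : nat) : int :=
  \sum_(k <- divisors n) mobius (n %/ k)%N * a k.

(** If [N] divides [n], substituting d = n / k gives N times the sum of mu over the divisors of n /
    N: this is n when N = n and 0 otherwise. If [N] does not divide [n], no term is left. *)
Lemma mobius_sum_multiples (N n : nat) : (0 < N)%N -> (0 < n)%N ->
  (n%:Z %| mobius_sum (fun k => if (N %| k)%N then N%:Z else 0) n)%Z.
Proof.
move=> N_gt0 n_gt0; rewrite /mobius_sum.
rewrite (eq_bigr (fun k => if (N %| k)%N then mobius (n %/ k)%N * N%:Z else 0));
  last by move=> k _; case: ifP => _; rewrite ?mulr0.
rewrite -big_mkcond -mulr_suml /=.
have [dvdNn|ndvd] := boolP (N %| n)%N; last first.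
  rewrite big_seq_cond big1 ?mul0r // => k /andP[].
  rewrite -dvdn_divisors // => dvdkn dvdNk.
  by rewrite (dvdn_trans dvdNk dvdkn) in ndvd.
have nN_gt0 : (0 < n %/ N)%N by rewrite divn_gt0 // dvdn_leq.
have -> : \sum_(k <- divisors n | (N %| k)%N) mobius (n %/ k)%N =
    \sum_(d <- divisors (n %/ N)) mobius d.
  rewrite -big_filter -(big_map (fun k => n %/ k)%N predT mobius).
  apply: perm_big; apply: uniq_perm; rewrite ?divisors_uniq //.
    rewrite map_inj_in_uniq ?filter_uniq ?divisors_uniq // => k l.
    rewrite !mem_filter -!dvdn_divisors // => /andP[_ dvdk] /andP[_ dvdl] eqkl.
    have k_gt0 := dvdn_gt0 n_gt0 dvdk; have l_gt0 := dvdn_gt0 n_gt0 dvdl.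
    have ek := divnK dvdk; have el := divnK dvdl.
    by apply/eqP; rewrite -(eqn_pmul2l (m := n %/ l)) ?el -?eqkl ?ek //
      divn_gt0 // dvdn_leq.
  move=> d; apply/mapP/idP => [[k]|].
    rewrite mem_filter -!dvdn_divisors // => /andP[dvdNk dvdkn] ->.
    have [j ek] := dvdnP dvdNk; have k_gt0 := dvdn_gt0 n_gt0 dvdkn.
    apply/dvdnP; exists j; apply/eqP.
    rewrite -(eqn_pmul2r N_gt0) divnK // -{1}(divnK dvdkn) {2}ek.
    by apply/eqP; ring.
  rewrite -dvdn_divisors // => /dvdnP[j ej].
  have en : n = (j * N * d)%N by rewrite -[LHS](divnK dvdNn) ej; ring.
  have [jN_gt0 d_gt0] : (0 < j * N /\ 0 < d)%N.
    by move: n_gt0; rewrite en !muln_gt0 => /andP[-> ->].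
  exists (j * N)%N; last by rewrite en mulKn.
  by rewrite mem_filter dvdn_mull // -dvdn_divisors // en dvdn_mulr.
have [e1|neq1] := eqVneq (n %/ N)%N 1%N.
  have eNn : N = n by rewrite -[RHS](divnK dvdNn) e1 mul1n.
  by rewrite eNn dvdz_mull.
by rewrite sum_mobius ?mul0r // ltn_neqAle eq_sym neq1.
Qed.

End Mobius.

(** * Gauss congruences *)

Section LogDerivative.
Variable R : comNzRingType.
Implicit Types H A : pseries R.

(** Division-free form of theta H / H = A for normalised [H]; products of series become sums of
    [A]. *)
Definition log_deriv H A := H 0%N = 1 /\ ps_theta H = A * H.

Lemma log_derivM H1 A1 H2 A2 : log_deriv H1 A1 -> log_deriv H2 A2 ->
  log_deriv (H1 * H2) (A1 + A2).
Proof.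
move=> [H10 eq1] [H20 eq2]; split; first by rewrite psM0 H10 H20 mulr1.
by rewrite ps_thetaM eq1 eq2; ring.
Qed.

Lemma log_derivX H A k : log_deriv H A -> log_deriv (H ^+ k) (A *+ k).
Proof.
move=> HA; elim: k => [|k IH]; last by rewrite exprS mulrS; apply: log_derivM.
split=> //; rewrite expr0 mulr0n mul0r.
by apply: psP => -[|n]; rewrite ps0 /= ?mul0r ?mulr0.
Qed.

Lemma log_deriv_inv H A K : log_deriv H A -> H * K = 1 -> log_deriv K (- A).
Proof.
move=> [H0 eqH] HK; have K0 : K 0%N = 1.
  by rewrite -[LHS]mul1r -H0 -psM0 HK.
split=> //; have : ps_theta (H * K) = 0.
  by rewrite HK; apply: psP => -[|n]; rewrite ps0 /= ?mul0r ?mulr0.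
rewrite ps_thetaM eqH => /(congr1 ( *%R K)).
have -> : K * (A * H * K + H * ps_theta K) = H * K * (A * K + ps_theta K).
  by ring.
by rewrite HK mul1r mulr0 mulNr addrC => /eqP; rewrite addr_eq0 => /eqP.
Qed.

End LogDerivative.

Section GaussCongruences.

(* The series 1 / (1 - z^N). *)
Definition geom (N : nat) : pseries int := PSeries (fun n => (N %| n)%N%:R).
Definition one_sub_pow (N : nat) : pseries int :=
  PSeries (fun n => (n == 0%N)%:R - (n == N)%:R).

Lemma geomM N : (0 < N)%N -> one_sub_pow N * geom N = 1.
Proof.
move=> N_gt0; apply: psP => n; rewrite psM ps1.
rewrite (eq_bigr (fun i : 'I_n.+1 => (val i == 0%N)%:R * (N %| n - i)%N%:R
  - (val i == N)%:R * (N %| n - i)%N%:R)); last first.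
  by move=> i _; rewrite /= mulrBl.
rewrite sumrB big_ord_recl /= mul1r subn0 big1 ?addr0; last first.
  by move=> i _; rewrite mul0r.
have [ltnN|leNn] := ltnP n N.
  rewrite big1 ?subr0 => [|i _].
    by case: n ltnN => [|n] ltnN; rewrite ?dvdn0 // gtnNdvd.
  by rewrite (ltn_eqF (leq_ltn_trans (leq_ord i) ltnN)) mul0r.
have ltNn : (N < n.+1)%N by [].
rewrite (bigD1 (Ordinal ltNn)) //= eqxx mul1r big1 ?addr0; last first.
  by move=> i; rewrite -val_eqE /= => /negPf->; rewrite mul0r.
by rewrite -{1}(subnK leNn) dvdn_addl // subrr gtn_eqF // (leq_trans N_gt0).
Qed.

(** The series N z^N / (1 - z^N), logarithmic derivative of 1 / (1 - z^N); hence no constant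
    term. *)
Definition geom_log (N : nat) : pseries int :=
  PSeries (fun n => if (0 < n)%N && (N %| n)%N then N%:Z else 0).

Lemma log_deriv_one_sub_pow N : (0 < N)%N ->
  log_deriv (one_sub_pow N) (- geom_log N).
Proof.
move=> N_gt0; split; first by rewrite /= eq_sym gtn_eqF // subr0.
(* In the form N (1 / (1 - z^N) - 1), multiplication by 1 - z^N yields N z^N at once. *)
have -> : - geom_log N = - (ps_of_poly (N%:R%:P) * (geom N - 1)).
  congr (- _); apply: psP => -[|n]; rewrite ps_mulC_poly psD psN ps1 /=.
    by rewrite dvdn0 subrr mulr0.
  by rewrite subr0; case: (N %| _)%N; rewrite ?mulr1 ?mulr0 ?natz.
rewrite mulNr -mulrA mulrBl mul1r mulrC [geom N * _]mulrC geomM //.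
apply: psP => n; rewrite psN mulrC ps_mulC_poly psD psN ps1 /=.
have [->|_] := eqVneq n N; first by rewrite gtn_eqF // mulr0n mulr1n; ring.
by case: n => [|n] /=; rewrite ?mulr0n ?mulr1n; ring.
Qed.

Lemma gauss_congruences (H A : pseries int) (n : nat) : log_deriv H A ->
  (0 < n)%N -> (n%:Z %| mobius_sum A n)%Z.
Proof.
move=> + n_gt0.
(* [N] is the first index at which [A] may still be nonzero, and [k] counts the remaining steps. At
   [k = 0] all divisors of [n] lie strictly between 0 and [N]. *)
suff main k N : (n < N + k)%N -> (0 < N)%N -> forall H A, log_deriv H A ->
    (forall i, (0 < i < N)%N -> A i = 0) -> (n%:Z %| mobius_sum A n)%Z.
  move=> HA; apply: (main n 1%N _ _ H A) => // i.
  by case: i => [|[]].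
elim: k N => [|k IH] N; [rewrite addn0|rewrite addnS -addSn];
  move=> lt_n N_gt0 {}H {}A HA A0.
  rewrite /mobius_sum big_seq big1 ?dvdz0 // => k.
  rewrite -dvdn_divisors // => dvdkn; rewrite A0 ?mulr0 //.
  by rewrite (dvdn_gt0 n_gt0 dvdkn) (leq_ltn_trans (dvdn_leq n_gt0 dvdkn)).
have [H0 eqH] := HA; set c := H N.
have A00 : A 0%N = 0.
  have := congr1 (fun f : pseries int => f 0%N) eqH.
  by rewrite psM0 H0 mulr1 /= mul0r.
(* In degree N of theta H = A H only the term [A N * H 0] survives. Integrality of [H] enters here:
   it makes [A N] a multiple of [N]. *)
have AN : A N = N%:Z * c.
  have := congr1 (fun f : pseries int => f N) eqH.
  rewrite psM big_ord_recr /= subnn H0 mulr1 natz => ->.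
  rewrite big1 ?add0r // => -[[|i] lti] _ /=; first by rewrite A00 mul0r.
  by rewrite A0 ?mul0r // lti.
(* [K] is (1 - z^N)^c; for negative [c] it is a power of [geom N]. *)
have HAN : exists K, log_deriv K (- (ps_of_poly c%:P * geom_log N)).
  have ldD := log_deriv_one_sub_pow N_gt0.
  have ldE := log_deriv_inv ldD (geomM N_gt0); rewrite opprK in ldE.
  case: (intP c) => [|m|m].
  - by exists 1; rewrite rmorph0 mul0r oppr0; apply: (log_derivX 0 ldD).
  - exists (one_sub_pow N ^+ m.+1); have := log_derivX m.+1 ldD.
    rewrite mulNrn; congr (log_deriv _ (- _)).
    by rewrite -natz !rmorph_nat mulr_natl.
  exists (geom N ^+ m.+1); have := log_derivX m.+1 ldE.
  congr (log_deriv _ _).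
  by rewrite -natz !rmorphN !rmorph_nat mulNr opprK mulr_natl.
have [K HK] := HAN.
(* [geom_log N] differs from the function on the right only at index 0, which is not a divisor of
   [n]. *)
have -> : mobius_sum A n = mobius_sum (A - ps_of_poly c%:P * geom_log N) n
   + c * mobius_sum (fun k => if (N %| k)%N then N%:Z else 0) n.
  rewrite /mobius_sum mulr_sumr -big_split big_seq [RHS]big_seq.
  apply: eq_bigr => j; rewrite -dvdn_divisors // => dvdjn.
  have -> : (A - ps_of_poly c%:P * geom_log N) j =
      A j - c * (if (N %| j)%N then N%:Z else 0).
    by rewrite psD psN ps_mulC_poly /= (dvdn_gt0 n_gt0 dvdjn).
  by rewrite /=; ring.
rewrite rpredD //; last by rewrite dvdz_mull ?mobius_sum_multiples.
apply: (IH N.+1 lt_n isT _ _ (log_derivM HA HK)) => i /andP[i_gt0].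
rewrite ltnS leq_eqVlt => /orP[/eqP->|ltiN]; rewrite psD psN ps_mulC_poly /=.
  by rewrite N_gt0 dvdnn AN mulrC subrr.
by rewrite i_gt0 A0 ?i_gt0 // gtnNdvd // mulr0 subr0.
Qed.

End GaussCongruences.

(** * Descent to the rationals and exponentials *)

Section Descent.
Variables (k K : fieldType) (f : {rmorphism k -> K}).

(* The k-rational relations satisfied by v span a proper subspace of k^n, which
   is therefore killed by some nonzero w over k. *)
Lemma descend_relations n (v : 'cV[K]_n) : v != 0 ->
  exists2 w : 'cV[k]_n, w != 0 &
    forall u : 'rV_n, map_mx f u *m v = 0 -> u *m w = 0.
Proof.
move=> nzv.
(* A matrix [M] of relations of maximal rank contains every relation in its row space, since
   adjoining one cannot raise the rank. *)
pose P r := `[< exists M : 'M[k]_n, \rank M = r /\ map_mx f M *m v = 0 >].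
have exP : exists r, P r.
  by exists 0%N; apply/asboolP; exists 0; rewrite mxrank0 map_mx0 mul0mx.
have ubP r : P r -> (r <= n)%N.
  by move=> /asboolP[M [<- _]]; apply: rank_leq_row.
case: (ex_maxnP exP ubP) => r /asboolP[M [rM Mv]] maxr.
have subM (u : 'rV_n) : map_mx f u *m v = 0 -> (u <= M)%MS.
  move=> uv; have le : (\rank (M + u)%MS <= \rank M)%N.
    rewrite rM; apply: maxr; apply/asboolP; exists (M + u)%MS; split=> //.
    have /submxP[D ->] : ((M + u)%MS <= col_mx M u)%MS by rewrite addsmxE.
    by rewrite map_mxM map_col_mx -mulmxA mul_col_mx Mv uv col_mx0 mulmx0.
  move: le; rewrite (geq_leqif (mxrank_leqif_sup (addsmxSl M u))) => le.
  exact: submx_trans (addsmxSr M u) le.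
have nfull : ~~ row_full M.
  apply: contraNN nzv => /row_fullP[B BM]; apply/eqP.
  by rewrite -[v]mul1mx -(map_mx1 f) -BM map_mxM -mulmxA Mv mulmx0.
have /matrix0Pn[i [j nzij]] : cokermx M != 0.
  rewrite -mxrank_eq0 mxrank_coker subn_eq0 -ltnNge.
  by rewrite ltn_neqAle rank_leq_col andbT.
exists (col j (cokermx M)).
  by apply: contraNneq nzij => /matrixP/(_ i 0); rewrite !mxE => ->.
move=> u /subM/submxP[D ->].
by rewrite -mulmxA colE (mulmxA M) mulmx_coker mul0mx mulmx0.
Qed.

(** With a range independent of [m], each coefficient of the product is a row built from [g] times
    the column of coefficients of [p]. *)
Lemma ps_of_polyM_bounded (F : fieldType) (p : {poly F}) n (g : pseries F) m :
    (size p <= n)%N ->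
  (ps_of_poly p * g) m =
    \sum_(i < n) p`_i * (if (i <= m)%N then g (m - i)%N else 0).
Proof.
move=> lepn; rewrite psM /=.
rewrite (big_ord_widen (n + m.+1) (fun i => p`_i * g (m - i)%N)) ?leq_addl //.
rewrite (big_ord_widen (n + m.+1)
  (fun i => p`_i * (if (i <= m)%N then g (m - i)%N else 0))) ?leq_addr //.
rewrite big_mkcond [RHS]big_mkcond; apply: eq_bigr => i _ /=.
rewrite ltnS; have [ltin|leni] := ltnP i n; first by case: ifP; rewrite ?mulr0.
by rewrite nth_default ?mul0r ?if_same // (leq_trans lepn).
Qed.

(** The vanishing of the coefficients of Q F from degree [size P] on is a linear system over [k]
    satisfied by the coefficients of [Q], so it has a nonzero solution over [k]. *)
Lemma descend_rational (F : pseries k) : fps_rational (ps_map f F) ->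
  exists P Q : {poly k}, Q != 0 /\ ps_of_poly Q * F = ps_of_poly P.
Proof.
case=> P [Q [nzQ eQ]]; pose n := size Q.
have {eQ}eQ : ps_of_poly Q * ps_map f F = ps_of_poly P.
  by apply: psP => m; apply: (congr1 (@^~ m) eQ).
pose v : 'cV[K]_n := \col_i Q`_i.
have nzv : v != 0.
  have ltn : (n.-1 < n)%N by rewrite prednK // size_poly_gt0.
  apply: contraNneq nzQ => /matrixP/(_ (Ordinal ltn) 0).
  by rewrite !mxE -lead_coefE => /eqP; rewrite lead_coef_eq0.
have [w nzw killw] := descend_relations nzv.
pose Q' := rVpoly w^T.
have szQ' : (size Q' <= n)%N by apply: size_poly.
have Q'i (i : 'I_n) : Q'`_i = w i 0 by rewrite coef_rVpoly_ord mxE.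
(* The numerator is Q' F cut at [size P]; the relations say that nothing is lost. *)
exists (\poly_(i < size P) (ps_of_poly Q' * F) i), Q'; split.
  apply: contraNneq nzw => Q'0; apply/eqP/matrixP => i j.
  by rewrite ord1 -Q'i Q'0 coef0 mxE.
apply: psP => m; rewrite [RHS]/= coef_poly; case: ltnP => // lePm.
pose u : 'rV[k]_n := \row_i (if (i <= m)%N then F (m - i)%N else 0).
have uv : map_mx f u *m v = 0.
  apply/matrixP => i j; rewrite !ord1 !mxE.
  have := congr1 (fun g : pseries K => g m) eQ.
  rewrite (ps_of_polyM_bounded _ _ (leqnn _)) /= nth_default // => e.
  rewrite -[RHS]e.
  apply: eq_bigr => l _; rewrite !mxE mulrC; congr (_ * _).
  by case: ifP => _; rewrite ?rmorph0.
have /matrixP/(_ 0 0) := killw u uv; rewrite !mxE => e; rewrite -[RHS]e.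
rewrite (ps_of_polyM_bounded _ _ szQ'); apply: eq_bigr => l _.
by rewrite Q'i mxE mulrC.
Qed.

Lemma fps_powE (F : fieldType) (g : nat -> F) n i :
  fps_pow g n i = (PSeries g ^+ n) i.
Proof.
elim: n i => [|n IH] i //; rewrite exprS psM.
transitivity (\sum_(j < i.+1) g j * fps_pow g n (i - j)%N); first by [].
by apply: eq_bigr => j _; rewrite IH.
Qed.

Lemma fps_exp_map (g : nat -> k) n : fps_exp (f \o g) n = f (fps_exp g n).
Proof.
rewrite /fps_exp rmorph_sum; apply: eq_bigr => i _.
rewrite rmorphM fmorphV rmorph_nat !fps_powE; congr (_ / _).
have -> : PSeries (f \o g) = ps_map f (PSeries g) by [].
by rewrite -rmorphXn.
Qed.

End Descent.

(** * The logarithmic derivative of a formal exponential *)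

Section Exponential.
Variable K : fieldType.
Hypothesis char0 : [pchar K] =i pred0.
Variable G : pseries K.
Hypothesis G0 : G 0%N = 0.

Lemma ps_expn_low n i : (i < n)%N -> (G ^+ n) i = 0.
Proof.
elim: n i => // n IH i lti; rewrite exprS psM big1 // => -[[|j] /= ltj] _.
  by rewrite G0 mul0r.
by rewrite IH ?mulr0 //; lia.
Qed.

Lemma ps_thetaX n : ps_theta (G ^+ n.+1) = n.+1%:R * ps_theta G * G ^+ n.
Proof.
elim: n => [|n IH]; first by rewrite expr1 expr0 mulr1 mul1r.
rewrite exprS ps_thetaM IH -[n.+2%:R]nat1r [G ^+ n.+1]exprS.
move: (n.+1%:R) (ps_theta G) => c dG; ring.
Qed.

(** Partial sums of exp G: being finite, they can be differentiated termwise, and they have the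
    right coefficients below degree [N]. *)
Definition exp_sum N : pseries K :=
  \sum_(i < N) ps_of_poly (i`!%:R^-1)%:P * G ^+ i.

Lemma exp_sumE N n : (n < N)%N -> exp_sum N n = fps_exp G n.
Proof.
move=> ltnN; rewrite ps_sum /fps_exp.
rewrite (big_ord_widen N (fun i => fps_pow G i n / i`!%:R)) // [RHS]big_mkcond.
apply: eq_bigr => i _; rewrite ps_mulC_poly /= mulrC fps_powE.
have -> : PSeries G = G by case: (G).
by rewrite ltnS; case: leqP => // /ps_expn_low ->; rewrite mul0r.
Qed.

Lemma exp_sum_theta N : ps_theta (exp_sum N.+1) = ps_theta G * exp_sum N.
Proof.
rewrite /exp_sum big_ord_recl raddfD raddf_sum /= mulr_sumr.
have -> : ps_theta (ps_of_poly (0`!%:R^-1)%:P * G ^+ 0) = 0.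
  rewrite fact0 invr1 expr0 mulr1.
  by apply: psP => -[|n]; rewrite /= ?coef1 ?mul0r ?mulr0.
rewrite add0r; apply: eq_bigr => i _.
rewrite ps_thetaM ps_theta_poly derivC mulr0 rmorph0 mul0r add0r ps_thetaX.
rewrite factS natrM invfM polyCM rmorphM /=.
have aux (a b c t g : pseries K) : a * c = 1 ->
    a * b * (c * t * g) = t * (b * g).
  by move=> ac; transitivity (a * c * (t * (b * g))); [ring | rewrite ac mul1r].
have : ps_of_poly (i.+1%:R^-1)%:P * i.+1%:R = 1 :> pseries K.
  have <- : ps_of_poly (i.+1%:R)%:P = i.+1%:R :> pseries K.
    by rewrite !rmorph_nat.
  by rewrite -!rmorphM mulVf ?rmorph1 //; move/pcharf0P: char0 => ->.
exact: aux.
Qed.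

Lemma fps_exp_log_deriv :
  log_deriv (PSeries (fps_exp G)) (ps_theta G).
Proof.
split; first by rewrite /= /fps_exp big_ord1 /fps_pow /= /fps_one divr1.
apply: psP => n; rewrite [LHS]/= -(@exp_sumE n.+1) //.
transitivity (ps_theta (exp_sum n.+1) n); first by [].
(* [exp_sum n] is reliable only below degree [n]; its coefficient at [n] is multiplied by the
   constant term of theta G, which is 0. *)
rewrite exp_sum_theta !psM; apply: eq_bigr => -[[|i] /= lti] _.
  by rewrite !mul0r.
by rewrite exp_sumE //; lia.
Qed.

End Exponential.

(** * Congruences for synchronization counts *)

Theorem theorem36 (R : realType) (X : topologicalType) (phi psi : X -> X)
    (tame : sync_tame phi psi)
    (rational_zeta : fps_rational (sync_zeta (complex R) phi psi)) :
  forall n : nat, (0 < n)%N ->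
    (\sum_(k <- divisors n) mobius (n %/ k)%N * (sync_count phi psi k)%:Z
       = 0 %[mod n%:Z])%Z.
Proof.
move=> n n_gt0.
(* The value at 0 must be 0, as theta G has no constant term; the Moebius sums only see positive
   indices. *)
pose A : pseries int :=
  PSeries (fun k => if k == 0%N then 0 else (sync_count phi psi k)%:Z).
pose G : pseries rat := PSeries (fun k =>
  if k == 0%N then 0 else (sync_count phi psi k)%:R / k%:R).
have GA : ps_theta G = ps_map intr A.
  apply: psP => -[|k] /=; first by rewrite mul0r.
  by rewrite mulrC divfK ?pnatr_eq0.
have [F0 dF] : log_deriv (PSeries (fps_exp G)) (ps_theta G).
  by apply: fps_exp_log_deriv => //; apply: pchar_num.
have [P [Q [nzQ eQ]]] : exists P Q : {poly rat},
    Q != 0 /\ ps_of_poly Q * PSeries (fps_exp G) = ps_of_poly P.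
  (* The complex zeta series is the image of a rational one, since its exponent has rational
     coefficients. *)
  apply: (@descend_rational _ _ (@ratr (complex R))).
  suff <- : sync_zeta (complex R) phi psi =
      ps_map (@ratr (complex R)) (PSeries (fps_exp G)) by [].
  apply/funext => k; rewrite -[RHS]fps_exp_map /sync_zeta.
  congr (fps_exp _ k); apply/funext => -[|j] /=; first by rewrite rmorph0.
  by rewrite rmorphM fmorphV !rmorph_nat.
rewrite GA in dF.
have [H eH] := rational_series_integral nzQ eQ F0 dF.
have HA : log_deriv H A.
  split; first by apply: (@intr_inj rat); move: F0; rewrite eH.
  by apply: iota_inj; rewrite ps_map_theta -eH dF eH -rmorphM.
have -> : \sum_(k <- divisors n) mobius (n %/ k) * (sync_count phi psi k)%:Z =
    mobius_sum A n.
  rewrite /mobius_sum big_seq [RHS]big_seq; apply: eq_bigr => k.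
  by rewrite -dvdn_divisors // => /(dvdn_gt0 n_gt0); case: k.
by apply/eqP; rewrite eqz_mod_dvd subr0 (gauss_congruences HA).
Qed.
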